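(* Let $\overline{p}(n)$ denote the number of overpartitions of $n$. If $a,b$ are positive integers with $a\ge b$, then \[\overline{p}(a)\,\overline{p}(b)>\overline{p}(a+b),\] except for $(a,b)=(1,1),(2,1)$.
   Context: An overpartition of a nonnegative integer $n$ is a partition of $n$ (a non-increasing sequence of positive integers summing to $n$) in which the last occurrence of each distinct part may be overlined. $\overline{p}(n)$ is the number of overpartitions of $n$; equivalently $\sum_{n\ge0}\overline{p}(n)q^n=\prod_{n\ge1}\frac{1+q^n}{1-q^n}$. *)

(* Defs.v *)
From mathcomp Require Import all_boot.

Set Implicit Arguments.
Unset Strict Implicit.
Unset Printing Implicit Defensive.

(* A sequence of pairs (part, overlined?).  The parts are listed in
   non-increasing order, and an overlined entry must be the last occurrence
   of its part: no later entry carries the same part. *)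
Definition is_overpartition (n : nat) (s : seq (nat * bool)) : bool :=
  let parts := [seq x.1 | x <- s] in
  [&& sorted geq parts,
      all (fun m => 0 < m) parts,
      sumn parts == n
    & pairwise (fun x y => x.2 ==> (x.1 != y.1)) s].

(* An overpartition of n has at most n parts, each at most n, so the finite
   type below loses none of them; overpartition_num_size confirms it. *)
Definition overpartition_num (n : nat) : nat :=
  #|[set s : n.-bseq ('I_n.+1 * bool) |
       is_overpartition n [seq (val x.1, x.2) | x <- s]]|.

Lemma overpartition_num_size (n : nat) (e : seq (seq (nat * bool))) :
  uniq e -> (forall s, (s \in e) = is_overpartition n s) ->
  overpartition_num n = size e.
Proof.
move=> ue eP.
pose f (s : n.-bseq ('I_n.+1 * bool)) := [seq (val x.1, x.2) | x <- s].
have f_inj : injective f.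
  move=> s t /inj_map st; apply: val_inj; apply: st.
  by move=> [i b] [j c] /= [/val_inj -> ->].
rewrite /overpartition_num cardE -(size_map f); apply/perm_size/uniq_perm => //.
  by rewrite map_inj_uniq // enum_uniq.
move=> s; rewrite eP; apply/mapP/idP => [[t]|os].
  by rewrite mem_enum inE => ot ->.
have /and4P[_ /allP pos /eqP sum _] := os.
have le_sum (r : seq nat) m : m \in r -> m <= sumn r.
  elim: r => //= k r IH; rewrite inE => /orP[/eqP->|/IH]; first exact: leq_addr.
  by move=> mr; rewrite (leq_trans mr) ?leq_addl.
have sz : size s <= n.
  rewrite -sum -(size_map fst s); elim: (map _ _) pos => //= k r IH pos.
  rewrite -add1n leq_add ?pos ?mem_head //.
  by apply: IH => x xr; apply: pos; rewrite inE xr orbT.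
pose g (x : nat * bool) : 'I_n.+1 * bool := (inord x.1, x.2).
have szg : size (map g s) <= n by rewrite size_map.
have fgs : f (Bseq szg) = s.
  rewrite /f /= -map_comp -[RHS]map_id; apply/eq_in_map => -[m b] ms /=.
  by rewrite inordK // ltnS -sum le_sum //; apply/mapP; exists (m, b).
by exists (Bseq szg); rewrite // mem_enum inE -/(f _) fgs.
Qed.

(* Main.v *)
(** Write p(n) for the number of overpartitions of n.  Taking the logarithmic
    derivative of prod (1 + q^d) / (1 - q^d) gives the positive recurrence
      n p(n) = sum_(1 <= k <= n) c(k) p(n - k),
      c(k) = 2 sum_(d | k, k / d odd) d,    2 k <= c(k) <= k (k + 1).
    Expand (a + b) p(a + b) this way and argue by induction on a + b.  The terms
    with k <= a are at most c(k) p(a - k) p(b), which add up to a p(a) p(b).  The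
    terms with k = a + j, 1 <= j <= b, are c(a + j) p(b - j); they add up to less
    than b p(a) p(b) as soon as c(a + j) < c(j) p(a), which the bounds on c give
    when (a + 1)(2 a + 1) < 2 p(a), that is, for a >= 9.  The cases a <= 8 are
    computed. *)

Require Import Defs.
From mathcomp Require Import all_boot all_order all_algebra zify ring.

Set Implicit Arguments.
Unset Strict Implicit.
Unset Printing Implicit Defensive.

Import GRing.Theory.

(** * Overpartitions with bounded parts *)

(* [k] is fuel: any [k >= m + n] gives the overpartitions of [n] with parts at
   most [m]. *)
Fixpoint overparts_rec (k m n : nat) : seq (seq (nat * bool)) :=
  if k is k'.+1 then
    if m is m'.+1 then
      overparts_rec k' m' n ++
      (if m <= n then
         [seq (m, false) :: s | s <- overparts_rec k' m (n - m)] ++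
         [seq (m, true) :: s | s <- overparts_rec k' m' (n - m)]
       else [::])
    else if n == 0 then [:: [::]] else [::]
  else if n == 0 then [:: [::]] else [::].

Definition overparts (m n : nat) := overparts_rec (m + n) m n.

(** Every recursive call lowers [m + n], so fuel beyond [m + n] is never spent. *)
Lemma overparts_rec_fuel k m n :
  m + n <= k -> overparts_rec k m n = overparts m n.
Proof.
have step l : forall m n, m + n <= l ->
    overparts_rec l.+1 m n = overparts_rec l m n.
  elim: l {k m n} => [|l IHl] [|m] n //; rewrite addSn ltnS => le_l.
  have unfold i : overparts_rec i.+1 m.+1 n = overparts_rec i m n ++
      (if m < n then
         [seq (m.+1, false) :: s | s <- overparts_rec i m.+1 (n - m.+1)] ++
         [seq (m.+1, true) :: s | s <- overparts_rec i m (n - m.+1)]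
       else [::]) by [].
  rewrite !unfold (IHl m n) //; case: leqP => // lt_mn.
  by rewrite (IHl m.+1) ?(IHl m) //; lia.
move=> le_k; rewrite /overparts -(subnK le_k).
elim: (k - _) => // l IHl; rewrite addSn step //; exact: leq_addl.
Qed.

Lemma overparts0 n : overparts 0 n = if n == 0 then [:: [::]] else [::].
Proof. by case: n. Qed.

(** Three blocks: [m.+1] is absent; it leads plain and may recur; it leads overlined, hence for the
    last time, and only smaller parts follow. *)
Lemma overpartsS m n : overparts m.+1 n =
  overparts m n ++
  (if m < n then
     [seq (m.+1, false) :: s | s <- overparts m.+1 (n - m.+1)] ++
     [seq (m.+1, true) :: s | s <- overparts m (n - m.+1)]
   else [::]).
Proof.
rewrite {1}/overparts addSn /= overparts_rec_fuel //.
by case: ifP => // lt_mn; rewrite !overparts_rec_fuel //; lia.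
Qed.

Definition parts_le (m : nat) (s : seq (nat * bool)) :=
  all (fun x : nat * bool => x.1 <= m) s.

Lemma sorted_geq_cons m (s : seq nat) :
  sorted geq (m :: s) = all (geq m) s && sorted geq s.
Proof.
by rewrite /= path_sortedE // => x y z /= yx zx; apply: leq_trans zx yx.
Qed.

Lemma is_overpartition_consF m n s :
  is_overpartition n ((m, false) :: s) =
  [&& 0 < m, m <= n, is_overpartition (n - m) s & parts_le m s].
Proof.
rewrite /is_overpartition [map _ _]/= sorted_geq_cons all_map /parts_le.
rewrite [all _ (_ :: _)]/= [sumn _]/= [pairwise _ _]/= all_predT /=.
have -> : (m + sumn [seq x.1 | x <- s] == n) =
          (m <= n) && (sumn [seq x.1 | x <- s] == n - m) by lia.
rewrite (eq_all (a2 := fun x : nat * bool => x.1 <= m)) //.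
by case: (all _ s); case: (sorted _ _); case: (0 < m); case: (m <= n);
  rewrite /= ?andbF ?andbT.
Qed.

Lemma is_overpartition_consT m n s :
  is_overpartition n ((m.+1, true) :: s) =
  [&& m < n, is_overpartition (n - m.+1) s & parts_le m s].
Proof.
rewrite /is_overpartition [map _ _]/= sorted_geq_cons all_map /parts_le.
rewrite [all _ (_ :: _)]/= [sumn _]/= [pairwise _ _]/=.
have -> : (m.+1 + sumn [seq x.1 | x <- s] == n) =
          (m < n) && (sumn [seq x.1 | x <- s] == n - m.+1) by lia.
(* An overlined head forces a strict descent: a part at most [m.+1] and distinct from it is at most
   [m]. *)
rewrite [X in _ = [&& _, _ & X]](eq_all
  (a2 := predI (preim fst (geq m.+1)) (fun x => m.+1 != x.1))); last first.
  by move=> x /=; lia.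
rewrite all_predI.
by do 2 case: (all _ s); case: (sorted _ _); case: (m < n);
  rewrite /= ?andbF ?andbT.
Qed.

Lemma parts_le_mono m m' s : m <= m' -> parts_le m s -> parts_le m' s.
Proof. by move=> le_m; apply: sub_all => x /leq_trans; apply. Qed.

Lemma mem_overparts m n s :
  (s \in overparts m n) = is_overpartition n s && parts_le m s.
Proof.
have [l] := ubnP (m + n); elim: l m n s => // l IHl m n s lt_l.
case: m lt_l => [|m] lt_l.
  rewrite overparts0; case: s => [|[x b] s].
    by rewrite /is_overpartition /= andbT eq_sym; case: n {lt_l}.
  rewrite (_ : _ \in _ = false); last by case: (n == 0).
  by apply/esym/negP => /andP[/and4P[_ /= /andP[+ _] _ _]] /andP[/=]; lia.
have consI b (t : seq (nat * bool)) x c r :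
    ((x, c) :: t \in [seq (m.+1, b) :: u | u <- r]) =
    [&& x == m.+1, c == b & t \in r].
  apply/mapP/and3P => [[u ur [-> -> ->]]|[/eqP-> /eqP-> tr]] //.
  by exists t.
rewrite overpartsS mem_cat IHl; last by lia.
case: s => [|[x b] s].
  rewrite andbT (_ : _ \in _ = false) ?orbF //.
  by case: ifP => // _; rewrite mem_cat; apply/negP => /orP[] /mapP[].
have -> : parts_le m.+1 ((x, b) :: s) = (x <= m.+1) && parts_le m.+1 s by [].
have -> : parts_le m ((x, b) :: s) = (x <= m) && parts_le m s by [].
(* A head other than [m.+1] leaves only the first block; sortedness then bounds all parts by the
   head. *)
have [eqx|nex] := eqVneq x m.+1; last first.
  rewrite (_ : (_ \in _) = false) ?orbF; last first.
    by case: ifP => // _; rewrite mem_cat !consI (negPf nex).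
  have -> : (x <= m.+1) = (x <= m) by lia.
  case: (leqP x m) => [le_xm|]; rewrite ?andbF //= .
  apply: andb_id2l => /and4P[+ _ _ _].
  rewrite [map _ _]/= sorted_geq_cons all_map => /andP[ge_x _].
  have le_x : parts_le x s := ge_x.
  by rewrite !(parts_le_mono _ le_x) //; lia.
rewrite eqx ltnn andbF leqnn /=.
case: ltnP => [lt_mn|le_nm]; last first.
  by case: b; rewrite ?is_overpartition_consT ?is_overpartition_consF;
     move: le_nm; rewrite leqNgt => /negPf->; rewrite ?andbF.
rewrite mem_cat !consI eqxx /= !IHl; try lia.
case: b; rewrite ?is_overpartition_consT ?is_overpartition_consF lt_mn /=.
  case: (boolP (parts_le m s)) => [/(parts_le_mono (leqnSn m))->|];
    by rewrite ?andbT ?andbF.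
by rewrite orbF -andbA andbb.
Qed.

(** The blocks are disjoint: the first has no part [m.+1], and the other two differ in the mark of
    the head. *)
Lemma overparts_uniq m n : uniq (overparts m n).
Proof.
have [l] := ubnP (m + n); elim: l m n => // l IHl m n lt_l.
case: m lt_l => [|m] lt_l; first by rewrite overparts0; case: (n == 0).
rewrite overpartsS cat_uniq IHl /=; last by lia.
case: ifP => //= lt_mn; rewrite cat_uniq !map_inj_uniq ?IHl /=; try lia;
  try by move=> ? ? [].
rewrite andbT; apply/andP; split; apply/hasPn => s; rewrite ?mem_cat.
  by case/orP => /mapP[t _ ->]; apply/negP;
     rewrite mem_overparts => /andP[_ /andP[/=]]; rewrite ltnn.
by case/mapP => t _ ->; apply/mapP => -[].
Qed.

Definition overpart_count (m n : nat) := size (overparts m n).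

Lemma overpart_count0 n : overpart_count 0 n = (n == 0).
Proof. by rewrite /overpart_count overparts0; case: (n == 0). Qed.

(** For generating functions: (1 - q^(m+1)) F_(m+1) = (1 + q^(m+1)) F_m. *)
Lemma overpart_countS m n : overpart_count m.+1 n =
  overpart_count m n + (if m < n then
    overpart_count m.+1 (n - m.+1) + overpart_count m (n - m.+1) else 0).
Proof.
rewrite {1}/overpart_count overpartsS size_cat; case: ifP => // _.
by rewrite size_cat !size_map.
Qed.

Lemma overpart_count_stable m n :
  n <= m -> overpart_count m n = overpart_count n n.
Proof.
elim: m => [|m IHm]; first by rewrite leqn0 => /eqP->.
rewrite leq_eqVlt => /orP[/eqP->//|lt_nm].
by rewrite overpart_countS ltnNge -ltnS lt_nm addn0 IHm.
Qed.

(** The free bound [m] lets one truncated product serve several values of [n] at once. *)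
Lemma overpartition_numE m n : n <= m -> overpartition_num n = overpart_count m n.
Proof.
move=> le_nm; rewrite overpart_count_stable //.
apply: overpartition_num_size; first exact: overparts_uniq.
move=> s; rewrite mem_overparts; apply/andb_idr => /and4P[_ _ /eqP <- _].
apply/allP => x xs; have: x.1 \in [seq y.1 | y <- s] by apply: map_f.
elim: {xs s}(map _ s) => //= y s IHs; rewrite inE => /orP[/eqP->|/IHs]; lia.
Qed.

Lemma overpartition_num0 : overpartition_num 0 = 1.
Proof. by rewrite (overpartition_numE (leqnn 0)). Qed.

(** * The logarithmic derivative recurrence *)

Section LogDerivative.

Local Open Scope ring_scope.

Variable R : comNzRingType.
Implicit Types (c f g : nat -> R) (e : R).

(** Power series are coefficient sequences here: this is multiplication by q^m, and [seq_conv] is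
    the Cauchy product. *)
Definition seq_shift (m : nat) f (n : nat) : R :=
  if (m <= n)%N then f (n - m)%N else 0.

Definition seq_conv c f (n : nat) : R := \sum_(i < n.+1) c i * f (n - i)%N.

Lemma seq_convC c f n : seq_conv c f n = seq_conv f c n.
Proof.
rewrite /seq_conv (reindex_inj rev_ord_inj) /=; apply: eq_bigr => i _.
by rewrite mulrC subSS subKn // -ltnS.
Qed.

Lemma seq_conv_shiftl m c f n :
  seq_conv (seq_shift m c) f n = seq_shift m (seq_conv c f) n.
Proof.
rewrite /seq_conv /seq_shift; case: leqP => [le_mn|lt_nm]; last first.
  by rewrite big1 // => i _; rewrite leqNgt (leq_trans (ltn_ord i) lt_nm) mul0r.
rewrite -(big_mkord xpredT (fun i => (if (m <= i)%N then c (i - m)%N else 0) *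
  f (n - i)%N)) (big_cat_nat (n := m)) //=; last by lia.
rewrite big_nat_cond big1 ?add0r; last first.
  by move=> i /andP[/andP[_ lt_im] _]; rewrite leqNgt lt_im mul0r.
rewrite -{1}[m]add0n big_addn subSn // big_mkord; apply: eq_bigr => i _.
by rewrite leq_addl addnK addnC subnDA.
Qed.

Lemma seq_conv_shiftr m c f n :
  seq_conv c (seq_shift m f) n = seq_shift m (seq_conv c f) n.
Proof.
rewrite seq_convC seq_conv_shiftl /seq_shift; case: ifP => // _.
exact: seq_convC.
Qed.

Lemma eq_seq_conv c1 c2 f1 f2 n : c1 =1 c2 -> f1 =1 f2 ->
  seq_conv c1 f1 n = seq_conv c2 f2 n.
Proof. by move=> ec ef; apply: eq_bigr => i _; rewrite ec ef. Qed.

Lemma seq_convDl c1 c2 a f n :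
  seq_conv (fun k => c1 k + a * c2 k) f n =
  seq_conv c1 f n + a * seq_conv c2 f n.
Proof.
rewrite /seq_conv big_distrr -big_split; apply: eq_bigr => i _ /=.
by rewrite mulrDl mulrA.
Qed.

Lemma seq_convDr c f1 f2 a n :
  seq_conv c (fun k => f1 k + a * f2 k) n =
  seq_conv c f1 n + a * seq_conv c f2 n.
Proof.
by rewrite seq_convC seq_convDl; congr (_ + _ * _); apply: seq_convC.
Qed.

(* [log_deriv c f] says that [c] is the coefficient sequence of q F'(q) / F(q),
   where F is the generating function of [f]. *)
Definition log_deriv c f := forall n, n%:R * f n = seq_conv c f n.

(* Coefficients of e m q^m / (1 - e q^m), the logarithmic derivative of
   1 / (1 - e q^m). *)
Definition geom_coef (m : nat) e (k : nat) : R :=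
  if (m %| k)%N && (0 < k)%N then e ^+ (k %/ m) * m%:R else 0.

(** This is G = q^m (e G + e m), the equation solved by G = e m q^m / (1 - e q^m). *)
Lemma geom_coefE m e k : (0 < m)%N ->
  geom_coef m e k = seq_shift m (fun i => e * geom_coef m e i +
                                   e * m%:R * (i == 0%N)%:R) k.
Proof.
move=> m_gt0; rewrite /geom_coef /seq_shift; case: (leqP m k) => [le_mk|lt_km].
  have k_gt0 : (0 < k)%N by lia.
  rewrite k_gt0 andbT subn_gt0 -{1 2}(subnK le_mk) dvdn_addl //.
  have [dvd_m|ndvd] := boolP (m %| k - m)%N; last first.
    rewrite /= mulr0 add0r (_ : (k - m == 0)%N = false) ?mulr0 //.
    by apply/negP => /eqP eq0; rewrite eq0 dvdn0 in ndvd.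
  rewrite divnDr // divnn m_gt0 addn1 exprS /=.
  case: ltnP => [lt_mk|ge_mk].
    rewrite (_ : (k - m == 0)%N = false); last by lia.
    by rewrite mulr0 addr0 mulrA.
  have -> : (k - m = 0)%N by lia.
  by rewrite div0n eqxx expr0 !mulr1 mulr0 add0r.
case: ifP => // /andP[/dvdn_leq le_mk /le_mk]; lia.
Qed.

Lemma seq_conv_delta f n : seq_conv (fun i => (i == 0%N)%:R) f n = f n.
Proof.
rewrite /seq_conv big_ord_recl /= mul1r subn0 big1 ?addr0 // => i _.
by rewrite mul0r.
Qed.

Lemma seq_conv_geom m e f n : (0 < m)%N ->
  seq_conv (geom_coef m e) f n =
  e * seq_shift m (seq_conv (geom_coef m e) f) n + e * m%:R * seq_shift m f n.
Proof.
move=> m_gt0; rewrite (eq_seq_conv n (fun k => geom_coefE e k m_gt0) (frefl f)).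
rewrite seq_conv_shiftl /seq_shift; case: ifP => _; last by rewrite !mulr0 addr0.
rewrite seq_convDl seq_conv_delta; congr (_ + _).
rewrite /seq_conv big_distrr; apply: eq_bigr => i _ /=; exact/esym/mulrA.
Qed.

(** The product rule for q d/dq applied to q^m F. *)
Lemma seq_shift_theta m f n :
  n%:R * seq_shift m f n =
  seq_shift m (fun k => k%:R * f k) n + m%:R * seq_shift m f n.
Proof.
rewrite /seq_shift; case: leqP => [le_mn|]; last by rewrite !mulr0 addr0.
by rewrite -{1}(subnK le_mn) natrD mulrDl.
Qed.

Lemma eq_seq_shift m f g n : f =1 g -> seq_shift m f n = seq_shift m g n.
Proof. by rewrite /seq_shift => ->. Qed.

(** Here F = (1 - e q^m) G, and the factor contributes minus the series of [geom_coef m e]. *)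
Lemma log_deriv_mul m e c f g : (0 < m)%N ->
  (forall n, f n = g n - e * seq_shift m g n) -> log_deriv c g ->
  log_deriv (fun k => c k - geom_coef m e k) f.
Proof.
move=> m_gt0 fE cg n.
have fE' k : f k = g k + (- e) * seq_shift m g k by rewrite fE mulNr.
rewrite (eq_seq_conv (c2 := fun k => c k + (-1) * geom_coef m e k) (f2 := f));
  [|by move=> k; rewrite mulN1r|by []].
rewrite seq_convDl !(eq_seq_conv n (frefl _) fE') !seq_convDr !seq_conv_shiftr.
rewrite (seq_conv_geom _ _ _ m_gt0) fE mulrBr mulrCA seq_shift_theta -!cg.
by rewrite (eq_seq_shift m n cg); ring.
Qed.

Lemma log_deriv_div m e c f g : (0 < m)%N ->
  (forall n, f n = g n - e * seq_shift m g n) -> log_deriv c f ->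
  log_deriv (fun k => c k + geom_coef m e k) g.
Proof.
move=> m_gt0 fE cf n.
rewrite (eq_seq_conv (c2 := fun k => c k + 1 * geom_coef m e k) (f2 := g));
  [|by move=> k; rewrite mul1r|by []].
rewrite seq_convDl mul1r.
(* In place of dividing by 1 - e q^m: the identity for [g] at [n] follows from that for [f] at [n]
   and that for [g] at [n - m]. *)
elim/ltn_ind: n => n IHn.
have fE' k : f k = g k + (- e) * seq_shift m g k by rewrite fE mulNr.
have := cf n; rewrite (eq_seq_conv n (frefl _) fE') seq_convDr seq_conv_shiftr.
rewrite fE mulrBr mulrCA seq_shift_theta (seq_conv_geom _ _ _ m_gt0).
have -> : seq_shift m (fun k => k%:R * g k) n =
  seq_shift m (seq_conv c g) n + seq_shift m (seq_conv (geom_coef m e) g) n.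
  by rewrite /seq_shift; case: ifP => [le_mn|_]; rewrite ?addr0 // IHn //; lia.
move=> /(canRL (subrK _))->; ring.
Qed.

End LogDerivative.

(* Coefficients of 2 m q^m / (1 - q^(2m)), the logarithmic derivative of
   (1 + q^m) / (1 - q^m). *)
Definition odd_coef (m k : nat) : nat :=
  if (m %| k) && odd (k %/ m) then m.*2 else 0.

(** The divisor sum c(k) restricted to d <= m, hence c(k) itself when 0 < k <= m; it vanishes at k =
    0, since the quotient 0 is even. *)
Definition overpart_coef (m k : nat) : nat := \sum_(d < m) odd_coef d.+1 k.

(** The difference 1 - (-1)^(k/m) is 2 for an odd quotient and 0 for an even one. *)
Lemma geom_coef_odd m k :
  (geom_coef m 1 k - geom_coef m (-1) k = (odd_coef m k)%:R :> int)%R.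
Proof.
rewrite /geom_coef /odd_coef; case: (m %| k) => //=.
case: k => [|k] /=; first by rewrite div0n subrr.
rewrite expr1n -signr_odd mul1r; case: (odd _); rewrite ?expr1 ?expr0 ?mul1r ?subrr //.
by rewrite mulN1r opprK -natrD addnn.
Qed.

Lemma overpart_count_log_deriv m :
  log_deriv (fun k => (overpart_coef m k)%:R : int)%R
            (fun n => (overpart_count m n)%:R : int)%R.
Proof.
elim: m => [|m IHm].
  move=> n; rewrite /seq_conv big1; last first.
    by move=> i _; rewrite /overpart_coef big_ord0 mul0r.
  by rewrite overpart_count0; case: n => [|n]; rewrite ?mul0r ?mulr0.
(* [h] is (1 + q^(m+1)) F_m = (1 - q^(m+1)) F_(m+1): first multiply with e = -1, then divide with e
   = 1. *)
pose h n : int := ((overpart_count m n)%:R -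
  (-1) * seq_shift m.+1 (fun k => (overpart_count m k)%:R) n)%R.
have h1 := log_deriv_mul (f := h) (ltn0Sn m) (fun n => erefl) IHm.
have h2 n : (h n = (overpart_count m.+1 n)%:R -
    1 * seq_shift m.+1 (fun k => (overpart_count m.+1 k)%:R) n)%R.
  rewrite /h /seq_shift overpart_countS; case: ifP => _; last first.
    by rewrite !mulr0 addn0.
  by rewrite !natrD; ring.
move=> n; rewrite (log_deriv_div (ltn0Sn m) h2 h1).
apply: eq_seq_conv => // k.
rewrite /overpart_coef big_ord_recr /= natrD -geom_coef_odd; ring.
Qed.

Lemma overpart_count_rec m n :
  n * overpart_count m n =
  \sum_(1 <= k < n.+1) overpart_coef m k * overpart_count m (n - k).
Proof.
have := overpart_count_log_deriv m n; rewrite /seq_conv.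
rewrite -natrM (eq_bigr (fun i : 'I_n.+1 =>
  (overpart_coef m i * overpart_count m (n - i))%:R%R)); last first.
  by move=> i _; rewrite natrM.
rewrite -natr_sum => /eqP; rewrite Num.Theory.eqr_nat => /eqP->.
rewrite -(big_mkord xpredT (fun i => overpart_coef m i * overpart_count m (n - i))).
by rewrite big_nat_recl // big_add1 /= [overpart_coef m 0]big1.
Qed.

Lemma leq_overpart_coef m k : 0 < k <= m -> k.*2 <= overpart_coef m k.
Proof.
case: k => // k lt_km.
rewrite /overpart_coef (bigD1 (Ordinal lt_km)) //= /odd_coef dvdnn divnn /=.
exact: leq_addr.
Qed.

Lemma overpart_coef_leq m k : overpart_coef m k <= k * k.+1.
Proof.
have E (n : nat) : \sum_(d < n) d.+1.*2 = n * n.+1.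
  by elim: n => [|n IHn]; rewrite ?big_ord0 // big_ord_recr /= IHn; lia.
(* Indices d > k add nothing, and those up to k add at most 2 (1 + ... + k). *)
suff: forall l, overpart_coef (k + l) k <= k * k.+1.
  case: (leqP k m) => [le_km /(_ (m - k))|lt_mk _]; first by rewrite subnKC.
  rewrite (@leq_trans (m * m.+1)) ?leq_mul // -?E; try lia.
  by apply: leq_sum => d _; rewrite /odd_coef; case: ifP.
elim=> [|l IHl].
  rewrite addn0 -E; apply: leq_sum => d _; rewrite /odd_coef; by case: ifP.
rewrite addnS /overpart_coef big_ord_recr /= -[X in _ <= X]addn0.
apply: leq_add; first exact: IHl.
rewrite /odd_coef; case: ifP => // /andP[dvd_k odd_k].
case: (posnP k) => [k0|/dvdn_leq/(_ dvd_k)]; last by lia.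
by rewrite k0 div0n in odd_k.
Qed.

(** * Growth *)

Lemma leq_overpart_count m1 m2 n :
  m1 <= m2 -> overpart_count m1 n <= overpart_count m2 n.
Proof.
elim: m2 => [|m2 IHm]; first by rewrite leqn0 => /eqP->.
rewrite leq_eqVlt => /orP[/eqP->//|/IHm le_m].
by rewrite (leq_trans le_m) // overpart_countS leq_addr.
Qed.

Lemma overpart_count1 n : overpart_count 1 n.+1 = 2.
Proof.
elim: n => // n IHn; rewrite overpart_countS /= subn1 /= IHn.
by rewrite !overpart_count0.
Qed.

Lemma overpart_count2 n : overpart_count 2 n.+1 = n.+1.*2.
Proof.
elim/ltn_ind: n => -[|[|n]] // IHn.
by rewrite overpart_countS /= !subSS subn0 IHn ?overpart_count1 //; lia.
Qed.

(** The increment is 2 n + 2 (n - 3); at n = 3 it fails, as the empty overpartition counts once. *)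
Lemma overpart_count3 n : 3 < n ->
  overpart_count 3 n = overpart_count 3 (n - 3) + (4 * n - 6).
Proof.
case: n => [|[|[|[|n]]]] // _; rewrite overpart_countS.
have -> : n.+4 - 3 = n.+1 by lia.
rewrite !overpart_count2 (_ : 2 < n.+4) //; lia.
Qed.

Lemma overpart_count4 n : 8 < n ->
  n.+1 * n.*2.+1 < (overpart_count 4 n).*2.
Proof.
elim/ltn_ind: n => n IHn lt8n.
(* The step goes from n - 4 to n, so the base cases are 9 to 12. *)
case: (ltnP n 13) => [|le13n].
  by move: lt8n {IHn}; do 13 (case: n => [|n] //); move=> _ _; vm_compute.
rewrite overpart_countS (ltn_trans _ le13n) //.
(* The quadratic grows by 16 n - 20 from n - 4 to n; these three increments, doubled, give at least
   24 n - 92. *)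
have := IHn (n - 4); have := @overpart_count3 n; have := @overpart_count3 (n - 3).
have := @overpart_count3 (n - 4); nia.
Qed.

Lemma overpartition_num_growth n : 8 < n ->
  n.+1 * n.*2.+1 < (overpartition_num n).*2.
Proof.
move=> lt8n; rewrite (leq_trans (overpart_count4 lt8n)) // leq_double.
rewrite (@overpartition_numE n) // leq_overpart_count //; lia.
Qed.

Lemma overpartition_num_gt0 n : 0 < overpartition_num n.
Proof.
rewrite (@overpartition_numE n.+1) //; case: n => // n.
by rewrite (leq_trans _ (leq_overpart_count _ (ltn0Sn n.+1))) // overpart_count1.
Qed.

(** * Submultiplicativity *)

Lemma overpartition_num_step a b : 8 < a -> 0 < b <= a ->
  (forall i, i < a -> overpartition_num (i + b) <=
                      overpartition_num i * overpartition_num b) ->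
  overpartition_num (a + b) < overpartition_num a * overpartition_num b.
Proof.
move=> lt8a /andP[b_gt0 le_ba] IH.
set p := overpartition_num in IH *; set c := overpart_coef (a + b).
have pE n : n <= a + b -> n * p n = \sum_(1 <= k < n.+1) c k * p (n - k).
  move=> le_n; rewrite /p (overpartition_numE le_n) overpart_count_rec.
  apply: eq_big_nat => k /andP[_ lt_kn]; rewrite (@overpartition_numE (a + b)) //.
  lia.
have lt_c j : 0 < j <= b -> c (a + j) < c j * p a.
  move=> /andP[j_gt0 le_jb]; have := overpartition_num_growth lt8a; rewrite -/p.
  have : j.*2 <= c j by apply: leq_overpart_coef; lia.
  have := overpart_coef_leq (a + b) (a + j); rewrite -/c => cu cl gr.
  apply: leq_ltn_trans cu _.
  apply: (@leq_trans (j.*2 * p a)); last by rewrite leq_mul2r cl orbT.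
  (* Since 1 <= j <= a, a + j <= j (a + 1) and a + j + 1 <= 2 a + 1; the growth bound puts the
     product below 2 j p(a). *)
  have : (a + j) * (a + j).+1 <= (j * a.+1) * a.*2.+1 by apply: leq_mul; nia.
  nia.
have lt_tail : \sum_(1 <= k < b.+1) c (a + k) * p (b - k) < b * p b * p a.
  rewrite pE ?leq_addl // big_distrl /= !big_add1 /= !big_mkord.
  (* Only the term k = 1 is kept strict: it exists as b > 0, and p(b - 1) > 0. *)
  case: (b) b_gt0 lt_c => // b' _ lt_c; rewrite !big_ord_recl /=.
  rewrite -addSn; apply: leq_add.
    rewrite mulnAC ltn_mul2r overpartition_num_gt0; apply: lt_c; lia.
  apply: leq_sum => i _; rewrite [X in _ <= X]mulnAC leq_mul2r ltnW ?orbT //.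
  by apply: lt_c; have := ltn_ord i; rewrite /bump /=; lia.
have le_head : \sum_(1 <= k < a.+1) c k * p (a + b - k) <= a * p a * p b.
  rewrite pE ?leq_addr // big_distrl /= !big_add1 /= !big_mkord.
  apply: leq_sum => i _; rewrite -mulnA leq_mul2l.
  have lt_ia := ltn_ord i.
  have -> : a + b - i.+1 = (a - i.+1) + b by lia.
  by rewrite IH ?orbT //; lia.
have ab_gt0 : 0 < a + b by lia.
rewrite -(ltn_pmul2l ab_gt0) pE // (big_cat_nat (n := a.+1)) //=; last by lia.
have -> : \sum_(a.+1 <= k < (a + b).+1) c k * p (a + b - k) =
          \sum_(1 <= k < b.+1) c (a + k) * p (b - k).
  rewrite -{1}[a.+1]add1n big_addn (_ : (a + b).+1 - a = b.+1); last by lia.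
  by apply: eq_bigr => k _; rewrite addnC subnDl.
rewrite mulnDl mulnA -addnS; apply: leq_add => //.
by rewrite (_ : b * (p a * p b) = b * p b * p a) //; ring.
Qed.

Lemma overpartition_num_small a b : 0 < b <= a -> a <= 8 ->
  (overpartition_num (a + b) <= overpartition_num a * overpartition_num b) &&
  ((overpartition_num (a + b) == overpartition_num a * overpartition_num b) ==
   ((a, b) \in [:: (1, 1); (2, 1)])).
Proof.
move=> /andP[b_gt0 le_ba] le_a8; rewrite !(@overpartition_numE 16); try lia.
(* A table up to 16 = 8 + 8 covers every index a + b. *)
pose t := [seq overpart_count 16 n | n <- iota 0 17].
have tE n : n <= 16 -> overpart_count 16 n = nth 0 t n.
  by move=> le_n; rewrite (nth_map 0) ?size_iota ?nth_iota.
rewrite !tE; try lia.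
have : all (fun a => all (fun b =>
  (nth 0 t (a + b) <= nth 0 t a * nth 0 t b) &&
  ((nth 0 t (a + b) == nth 0 t a * nth 0 t b) ==
   ((a, b) \in [:: (1, 1); (2, 1)]))) (iota 1 a)) (iota 1 8) by vm_compute.
move=> /allP/(_ a); rewrite mem_iota => /(_ _)/allP; apply; first by lia.
by rewrite mem_iota; lia.
Qed.

(** Non-strict, unordered and with zero allowed, because the step calls on all pairs (i, b) with i <
    a, including i = 0 and the exceptional pairs. *)
Lemma overpartition_num_submul a b :
  overpartition_num (a + b) <= overpartition_num a * overpartition_num b.
Proof.
have [l] := ubnP (a + b); elim: l a b => // l IHl a b.
wlog le_ba : a b / b <= a.
  move=> W; case: (leqP b a) => [|/ltnW]; first exact: W.
  by rewrite addnC mulnC; apply: W.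
move=> lt_l; case: (posnP b) => [->|b_gt0].
  by rewrite addn0 overpartition_num0 muln1.
have b_bounds : 0 < b <= a by rewrite b_gt0.
case: (leqP a 8) => [le_a8|lt8a].
  by case/andP: (overpartition_num_small b_bounds le_a8).
apply/ltnW/overpartition_num_step => // i lt_ia.
by apply: IHl; lia.
Qed.

Theorem theorem1p3 (a b : nat) (b_gt0 : 0 < b) (le_ba : b <= a) :
  overpartition_num (a + b) < overpartition_num a * overpartition_num b <->
  ~ ((a, b) = (1, 1) \/ (a, b) = (2, 1)).
Proof.
have b_bounds : 0 < b <= a by rewrite b_gt0.
case: (leqP a 8) => [le_a8|lt8a].
  have /andP[le_p /eqP eq_p] := overpartition_num_small b_bounds le_a8.
  rewrite ltn_neqAle le_p andbT eq_p !inE negb_or; split.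
    by move=> /andP[/eqP n1 /eqP n2] [].
  by move=> n12; apply/andP; split; apply/eqP => e; apply: n12; [left|right].
split=> [_ [] [e _]|_]; [lia|lia|].
apply: overpartition_num_step => // i _.
exact: overpartition_num_submul.
Qed.
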